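(* Let $\mathcal{E}$ be an $n$-dimensional nilpotent evolution algebra over a field $\mathbb{K}$. Then the following are equivalent: (i) $\mathcal{E}$ has maximum index of nilpotency; (ii) the subalgebra lattice of $\mathcal{E}$ is a chain of length $n$; (iii) $\mathcal{E}$ is distributive; (iv) $\mathcal{E}$ is spanned (as a vector space) by the principal powers of an element, i.e. there is $u\in\mathcal{E}$ such that $\mathcal{E}$ is the linear span of $\{u^k : k\geq 1\}$.
   Context: An evolution algebra over a field $\mathbb{K}$ is a finite-dimensional $\mathbb{K}$-algebra $\mathcal{E}$ (bilinear product, not necessarily associative) admitting a basis $B=\{e_1,\dots,e_n\}$, called a natural basis, with $e_ie_j=0$ for $i\neq j$. Put $\mathcal{E}^1=\mathcal{E}$ and $\mathcal{E}^{k+1}=\sum_{i=1}^k\mathcal{E}^i\mathcal{E}^{k+1-i}$. $\mathcal{E}$ is nilpotent if $\mathcal{E}^k=0$ for some $k$; the least such $k$ is its index of nilpotency. An $n$-dimensional nilpotent evolution algebra has maximum index of nilpotency if this index is the largest possible among $n$-dimensional nilpotent evolution algebras. (Known facts: a nilpotent evolution algebra has a natural basis for which the structure matrix $(a_{ik})$, $e_i^2=\sum_k a_{ik}e_k$, is strictly upper triangular; with respect to such a basis, the index of nilpotency is maximum if and only if $a_{i(i+1)}\neq 0$ for all $1\leq i\leq n-1$.) For subsets $S$, $\langle S\rangle$ denotes the subalgebra generated by $S$. $\mathcal{E}$ is distributive if $\langle U,V\cap W\rangle=\langle U,V\rangle\cap\langle U,W\rangle$ for all subalgebras $U,V,W$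 of $\mathcal{E}$. The subalgebra lattice is the set of all subalgebras (including $0$ and $\mathcal{E}$) ordered by inclusion; a chain of length $n$ is a totally ordered set $U_0\subsetneq U_1\subsetneq\dots\subsetneq U_n$. Principal powers of $u$: $u^1=u$, $u^k=u^{k-1}u$. *)

(* Defs.v *)
From HB Require Import structures.
From mathcomp Require Import all_boot all_order all_algebra.

Set Implicit Arguments.
Unset Strict Implicit.
Unset Printing Implicit Defensive.

Import GRing.Theory.
Local Open Scope ring_scope.

(* MathComp's algebra structures are associative and unital, so a
   finite-dimensional (not necessarily associative) algebra is given here as a
   finite-dimensional vector space with a bilinear product. *)

Definition natural_basis (K : fieldType) (E : vectType K)
    (mul : {bilinear E -> E -> E}) n (B : n.-tuple E) : Prop :=
  basis_of fullv B /\
  forall i j : 'I_n, i != j -> mul (tnth B i) (tnth B j) = 0.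

Definition evolution_algebra (K : fieldType) (E : vectType K)
    (mul : {bilinear E -> E -> E}) : Prop :=
  exists B : (\dim {:E}).-tuple E, natural_basis mul B.

(* The span of all products u v with u in U and v in V; see prod_vspace_subP
   for the independence from the choice of bases. *)
Definition prod_vspace (K : fieldType) (E : vectType K)
    (mul : {bilinear E -> E -> E}) (U V : {vspace E}) : {vspace E} :=
  <<[seq mul u v | u <- vbasis U, v <- vbasis V]>>%VS.

(* [:: E^1; ...; E^k], with E^(i+1) at position i. *)
Fixpoint alg_powers (K : fieldType) (E : vectType K)
    (mul : {bilinear E -> E -> E}) (k : nat) : seq {vspace E} :=
  if k is k'.+1 then
    let s := alg_powers mul k' in
    rcons s (if k' is 0%N then fullv
             else (\sum_(i < k')
                    prod_vspace mul (nth 0 s i) (nth 0 s (k' - i.+1)))%VS)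
  else [::].

(* E^k for k >= 1 (see alg_powS for the recursion); E^0 is a junk value. *)
Definition alg_pow (K : fieldType) (E : vectType K)
    (mul : {bilinear E -> E -> E}) (k : nat) : {vspace E} :=
  nth 0%VS (alg_powers mul k) k.-1.

Definition nilpotent_algebra (K : fieldType) (E : vectType K)
    (mul : {bilinear E -> E -> E}) : Prop :=
  exists2 k : nat, (0 < k)%N & alg_pow mul k = 0%VS.

Definition nilpotency_index (K : fieldType) (E : vectType K)
    (mul : {bilinear E -> E -> E}) (k : nat) : Prop :=
  [/\ (0 < k)%N, alg_pow mul k = 0%VS
    & forall j : nat, (0 < j)%N -> alg_pow mul j = 0%VS -> (k <= j)%N].

Definition max_nilpotency_index (K : fieldType) (E : vectType K)
    (mul : {bilinear E -> E -> E}) : Prop :=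
  exists2 k : nat, nilpotency_index mul k &
    forall (F : vectType K) (mulF : {bilinear F -> F -> F}) (l : nat),
      \dim {:F} = \dim {:E} -> evolution_algebra mulF ->
      nilpotent_algebra mulF -> nilpotency_index mulF l -> (l <= k)%N.

Definition subalgebra (K : fieldType) (E : vectType K)
    (mul : {bilinear E -> E -> E}) (U : {vspace E}) : Prop :=
  {in U &, forall u v, mul u v \in U}.

(* The subalgebra <S> generated by S, as a predicate: the intersection of all
   subalgebras containing S. *)
Definition in_gen_subalgebra (K : fieldType) (E : vectType K)
    (mul : {bilinear E -> E -> E}) (S : {pred E}) (x : E) : Prop :=
  forall A : {vspace E}, subalgebra mul A -> {subset S <= A} -> x \in A.

Definition distributive_algebra (K : fieldType) (E : vectType K)
    (mul : {bilinear E -> E -> E}) : Prop :=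
  forall U V W : {vspace E},
    subalgebra mul U -> subalgebra mul V -> subalgebra mul W ->
    forall x : E,
      in_gen_subalgebra mul [predU U & (V :&: W)%VS] x <->
      in_gen_subalgebra mul [predU U & V] x /\
      in_gen_subalgebra mul [predU U & W] x.

Definition subalgebra_lattice_chain (K : fieldType) (E : vectType K)
    (mul : {bilinear E -> E -> E}) (n : nat) : Prop :=
  exists U : 'I_n.+1 -> {vspace E},
    (forall i j : 'I_n.+1, (i < j)%N -> (U i <= U j)%VS && (U i != U j)) /\
    (forall A : {vspace E}, subalgebra mul A <-> exists i, A = U i).

(* u^k for k >= 1, with u^(k+1) = u^k u; k = 0 yields the junk value u. *)
Definition principal_power (K : fieldType) (E : vectType K)
    (mul : {bilinear E -> E -> E}) (u : E) (k : nat) : E :=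
  iter k.-1 (fun v => mul v u) u.

(* The span of the infinite family (u^k), k >= 1, is the union of the spans of
   u^1, ..., u^m. *)
Definition spanned_by_principal_powers (K : fieldType) (E : vectType K)
    (mul : {bilinear E -> E -> E}) : Prop :=
  exists u : E, forall x : E, exists m : nat,
    x \in <<[seq principal_power mul u k | k <- iota 1 m]>>%VS.

Lemma prod_vspace_subP (K : fieldType) (E : vectType K)
    (mul : {bilinear E -> E -> E}) (U V W : {vspace E}) :
  (prod_vspace mul U V <= W)%VS <->
  {in U & V, forall u v, mul u v \in W}.
Proof.
split=> [/span_subvP sW u v uU vV | mW].
  rewrite (coord_vbasis uU) (coord_vbasis vV) linear_sumlz.
  apply: memv_suml => i _; rewrite linear_sumr; apply: memv_suml => j _.
  rewrite linearZl_LR linearZr_LR; do 2!apply: memvZ.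
  by apply/sW/allpairs_f; apply: mem_nth; rewrite size_tuple.
apply/span_subvP => _ /allpairsP[[u v] /= [uU vV ->]].
by apply: mW; apply: vbasis_mem.
Qed.

Lemma size_alg_powers (K : fieldType) (E : vectType K)
    (mul : {bilinear E -> E -> E}) k : size (alg_powers mul k) = k.
Proof. by elim: k => //= k IHk; rewrite size_rcons IHk. Qed.

Lemma nth_alg_powers (K : fieldType) (E : vectType K)
    (mul : {bilinear E -> E -> E}) k i :
  (i < k)%N -> nth 0%VS (alg_powers mul k) i = alg_pow mul i.+1.
Proof.
elim: k => // k IHk; rewrite ltnS leq_eqVlt => /predU1P[-> // | lt_ik].
by rewrite -IHk //= nth_rcons size_alg_powers lt_ik.
Qed.

Lemma alg_pow1 (K : fieldType) (E : vectType K)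
    (mul : {bilinear E -> E -> E}) : alg_pow mul 1 = fullv.
Proof. by []. Qed.

Lemma alg_powS (K : fieldType) (E : vectType K)
    (mul : {bilinear E -> E -> E}) k : (0 < k)%N ->
  alg_pow mul k.+1 =
  (\sum_(1 <= i < k.+1)
    prod_vspace mul (alg_pow mul i) (alg_pow mul (k.+1 - i)))%VS.
Proof.
case: k => // k _; rewrite {1}/alg_pow [k.+2.-1]/= big_add1 big_mkord.
rewrite -/(alg_powers mul k.+2) [alg_powers mul k.+2]/=.
rewrite -/(alg_powers mul k.+1) nth_rcons size_alg_powers ltnn eqxx.
apply: eq_bigr => i _.
have e := nth_alg_powers mul (ltn_ord i).
have e' : nth 0%VS (alg_powers mul k.+1) (k.+1 - i.+1)
        = alg_pow mul (k.+1 - i.+1).+1.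
  by apply: nth_alg_powers; rewrite subSS ltnS leq_subr.
rewrite [LHS](congr2 (prod_vspace mul) e e'); congr prod_vspace.
by rewrite !subSS subSn // -ltnS.
Qed.

(* Main.v *)
(* A nilpotent evolution algebra has a natural basis e_1, ..., e_n with e_i^2 in
   V_(i+1) = <e_(i+1), ..., e_n>, and all four properties are equivalent to
   a_(i,i+1) <> 0 for all i < n.

   If the superdiagonal has no zero, squaring sends V_i \ V_(i+1) into
   V_(i+1) \ V_(i+2). Hence a nonzero subalgebra contained in V_i but not in
   V_(i+1) has elements of every depth >= i and equals V_i; the repeated squares
   of e_1 give E^(2^(n-1)) <> 0; and u = e_1 + ... + e_n has u^k in
   V_k \ V_(k+1), so its principal powers span E.

   If some a_(i,i+1) = 0, then V_i E and V_(i+1) E both lie in V_(i+2), so E^2 has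
   codimension at least 2. This excludes a spanning sequence of principal powers
   and distributivity (every subspace containing E^2 is a subalgebra). A
   filtration of length l with V_k E in V_(k+1) forces E^m = 0 for
   m > 2^(l-1), and V_(i+1) can be dropped, so E^(2^(n-1)) = 0, while the
   algebra with e_i^2 = e_(i+1) has E^(2^(n-1)) <> 0. *)

From HB Require Import structures.
Require Import Defs.
From mathcomp Require Import all_boot all_order all_algebra.

Set Implicit Arguments.
Unset Strict Implicit.
Unset Printing Implicit Defensive.

Import GRing.Theory.
Local Open Scope ring_scope.

(** * Powers of an algebra *)

Section AlgebraPowers.

Variables (K : fieldType) (E : vectType K) (mul : {bilinear E -> E -> E}).

Lemma mem_alg_pow1 x : x \in alg_pow mul 1.
Proof. by rewrite alg_pow1 memvf. Qed.

Lemma mul_alg_pow i j x y : (0 < i)%N -> (0 < j)%N ->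
  x \in alg_pow mul i -> y \in alg_pow mul j -> mul x y \in alg_pow mul (i + j).
Proof.
case: i => // i; case: j => // j _ _ xi yj; rewrite addnS alg_powS //.
have lt_i : (i < i.+1 + j)%N by rewrite addSn ltnS leq_addr.
rewrite big_add1 big_mkord.
apply: (subvP (sumv_sup (Ordinal lt_i) _ (subvv _))) => //=.
by apply: (iffLR (prod_vspace_subP _ _ _ _) (subvv _)); rewrite //
  addSn subSS -addnS addKn.
Qed.

Lemma alg_pow_subP k (W : {vspace E}) : (0 < k)%N ->
  (forall i j x y, (0 < i)%N -> (0 < j)%N -> (i + j)%N = k.+1 ->
     x \in alg_pow mul i -> y \in alg_pow mul j -> mul x y \in W) ->
  (alg_pow mul k.+1 <= W)%VS.
Proof.
move=> k_gt0 mulW; rewrite alg_powS // big_add1 big_mkord.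
apply/subv_sumP => i _; apply/prod_vspace_subP => x y xi yj.
apply: (mulW i.+1 (k.+1 - i.+1)%N) => //; first by rewrite subn_gt0 ltnS.
by rewrite subnKC // ltnW // ltnS.
Qed.

(** Strong induction: in a product of total degree at least 3 one factor has degree at least 2, and
    the induction hypothesis lowers that degree by one. *)
Lemma alg_powSS k : (0 < k)%N -> (alg_pow mul k.+1 <= alg_pow mul k)%VS.
Proof.
elim/ltn_ind: k => -[//|[|k]] IHk _; first exact: subvf.
apply: alg_pow_subP => // i [//|j] x y; case: i => [//|[|i]] _ _ Dij xi yj.
  rewrite [k.+2](_ : _ = 1 + k.+1)%N //; apply: mul_alg_pow => //.
  have Dj : j = k.+1 by apply: succn_inj; apply: succn_inj; rewrite -Dij.
  by apply: (subvP (IHk k.+1 _ _)) => //; rewrite -Dj.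
have Dk : (i.+1 + j.+1)%N = k.+2 by apply: succn_inj; rewrite -addSn.
rewrite -Dk.
apply: mul_alg_pow => //; apply: (subvP (IHk i.+1 _ _)) => //.
by rewrite -ltnS -Dk -addSnnS leq_addr.
Qed.

Lemma alg_pow_anti i j : (0 < i)%N -> (i <= j)%N ->
  (alg_pow mul j <= alg_pow mul i)%VS.
Proof.
move=> i_gt0 /subnK <-; elim: (j - i)%N => // d IHd.
by apply: subv_trans IHd; rewrite addSn alg_powSS // addn_gt0 i_gt0 orbT.
Qed.

Lemma nilpotency_indexP :
  nilpotent_algebra mul -> exists k, nilpotency_index mul k.
Proof.
case=> k0 k0_gt0 Ek0.
have exP : exists k, (0 < k)%N && (alg_pow mul k == 0%VS).
  by exists k0; rewrite k0_gt0 Ek0 eqxx.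
case: (ex_minnP exP) => k /andP[k_gt0 /eqP Ek] mink; exists k; split=> // j j0 Ej.
by apply: mink; rewrite j0 Ej eqxx.
Qed.

(* A product of degree m > 2^k has a factor of degree > 2^(k-1), so it lies one
   step further down in the filtration than that factor. *)
Lemma alg_pow_filtration (V : nat -> {vspace E}) :
  commutative mul -> V 0%N = fullv ->
  (forall k x y, x \in V k -> mul x y \in V k.+1) ->
  forall k m, (0 < m)%N -> (2 ^ k < m.*2)%N -> (alg_pow mul m <= V k)%VS.
Proof.
move=> mulC V0 mulV; elim=> [|k IHk] [|[|m]] // _ lt_k_m.
- by rewrite V0 subvf.
- by rewrite V0 subvf.
- by move: lt_k_m; rewrite expnS mul2n ltn_double ltnNge expn_gt0.
apply: alg_pow_subP => // i j x y i_gt0 j_gt0 Dij xi yj.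
have [lt_ki | le_ik] := ltnP (2 ^ k) i.*2.
  by apply: mulV; apply: subvP xi; apply: IHk.
rewrite mulC; apply: mulV; apply: subvP yj; apply: IHk => //.
move: lt_k_m; rewrite -Dij expnS mul2n ltn_double => lt_k_ij.
rewrite ltnNge; apply: contraL lt_k_ij => le_jk; rewrite -leqNgt -leq_double.
by rewrite doubleD -[X in (_ <= X)%N]addnn leq_add.
Qed.

End AlgebraPowers.

(** * The flag attached to an ordered basis *)

Section Tails.

Variables (K : fieldType) (E : vectType K) (n : nat) (B : n.-tuple E).
Hypothesis basisB : basis_of fullv B.

(** In the 1-based notation above, [tail k] is V_(k+1). *)
Definition tail k := <<drop k B>>%VS.

Lemma tail0 : tail 0 = fullv.
Proof. by rewrite /tail drop0 (span_basis basisB). Qed.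

Lemma tail_ge k : (n <= k)%N -> tail k = 0%VS.
Proof. by move=> le_nk; rewrite /tail drop_oversize ?size_tuple // span_nil. Qed.

Lemma dim_tail k : \dim (tail k) = (n - k)%N.
Proof.
have /eqP-> : free (drop k B).
  by apply: (catr_free (X := take k B)); rewrite cat_take_drop (basis_free basisB).
by rewrite size_drop size_tuple.
Qed.

Lemma tailP k x :
  reflect (forall i : 'I_n, (i < k)%N -> coord B i x = 0) (x \in tail k).
Proof.
apply: (iffP idP) => [xk i lt_ik | x0].
  rewrite (coord_span (X := in_tuple (drop k B)) xk) linear_sum big1 // => j _.
  have lt_kj : (k + j < n)%N by rewrite -ltn_subRL
    -[X in (X - _)%N](size_tuple B) -size_drop.
  rewrite linearZ /= nth_drop (coord_free (Ordinal lt_kj)) ?(basis_free basisB) //.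
  by rewrite -val_eqE /= gtn_eqF ?mulr0 // (leq_trans lt_ik) ?leq_addr.
rewrite (coord_basis basisB (memvf x)); apply: memv_suml => i _.
have [/x0-> | le_ki] := ltnP i k; first by rewrite scale0r mem0v.
apply/memvZ/memv_span; rewrite -(subnKC le_ki) -nth_drop mem_nth //.
by rewrite size_drop size_tuple ltn_sub2r // (leq_ltn_trans le_ki).
Qed.

Lemma tail_anti j k : (j <= k)%N -> (tail k <= tail j)%VS.
Proof.
by move=> le_jk; apply/subvP=> x /tailP x0; apply/tailP => i /leq_trans/(_ le_jk)/x0.
Qed.

Lemma memv_tailS (k : 'I_n) x :
  x \in tail k -> (x \in tail k.+1) = (coord B k x == 0).
Proof.
move/tailP=> x0; apply/tailP/eqP=> [-> // | xk0 i].
by rewrite ltnS leq_eqVlt => /predU1P[/val_inj-> | /x0].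
Qed.

(** Echelon argument, by descending induction on k: one vector of W at each exact depth suffices. *)
Lemma tail_subv k (W : {vspace E}) :
  (forall j, (k <= j < n)%N ->
    exists x, [/\ x \in W, x \in tail j & x \notin tail j.+1]) ->
  (tail k <= W)%VS.
Proof.
have [le_nk _ | lt_kn] := leqP n k; first by rewrite tail_ge ?sub0v.
rewrite -(subKn (ltnW lt_kn)); move: (n - k)%N (leq_subr k n) => d.
elim: d => [|d IHd] le_dn hW; first by rewrite subn0 tail_ge ?sub0v.
have lt_n : (n - d.+1 < n)%N by rewrite ltn_subrL (leq_trans _ le_dn).
have Dd : (n - d = (n - d.+1).+1)%N by rewrite subnSK.
have sW : (tail (n - d) <= W)%VS.
  apply: IHd (ltnW le_dn) _ => j /andP[le_j lt_j]; apply: hW.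
  by rewrite lt_j ltnW // -Dd.
have [|x [xW xt]] := hW (n - d.+1)%N; first by rewrite leqnn.
pose i := Ordinal lt_n; rewrite (memv_tailS (k := i)) // => xi0.
(* Cancelling coordinate i of y by a multiple of x moves y into the next tail, which already lies in
   W. *)
apply/subvP => y yt; rewrite -(subrK (coord B i y / coord B i x *: x) y).
apply: memvD; last exact: memvZ.
apply: (subvP sW); rewrite Dd (memv_tailS (k := i)) ?memvB ?memvZ //.
by rewrite linearB linearZ /= divfK // subrr.
Qed.

End Tails.

(** * Strictly triangular natural bases *)

Section TriangularBases.

Variables (K : fieldType) (E : vectType K) (mul : {bilinear E -> E -> E}).

Definition triangular_basis n (B : n.-tuple E) : Prop :=
  natural_basis mul B /\ forall i : 'I_n, mul B`_i B`_i \in tail B i.+1.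

(** For a triangular basis this is a_(i,i+1) <> 0; tails avoid forming the index i+1 in ['I_n]. *)
Definition nonzero_superdiagonal n (B : n.-tuple E) : Prop :=
  forall i : 'I_n, (i.+1 < n)%N -> mul B`_i B`_i \notin tail B i.+2.

Lemma mul_natural n (B : n.-tuple E) x y : natural_basis mul B ->
  mul x y = \sum_i (coord B i x * coord B i y) *: mul B`_i B`_i.
Proof.
case=> basisB B0; rewrite {1}(coord_basis basisB (memvf x)).
rewrite linear_sumlz; apply: eq_bigr => i _.
rewrite {1}(coord_basis basisB (memvf y)) linear_sumr (bigD1 i) //= big1 ?addr0.
  by rewrite linearZl_LR linearZr_LR scalerA.
move=> j /negPf i'j; rewrite linearZl_LR linearZr_LR -!tnth_nth B0 ?scaler0 //.
by rewrite eq_sym i'j.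
Qed.

Lemma evolution_mulC : evolution_algebra mul -> commutative mul.
Proof.
case=> B natB x y; rewrite !(mul_natural _ _ natB).
by apply: eq_bigr => i _; rewrite mulrC.
Qed.

Section Triangular.

Variables (n : nat) (B : n.-tuple E).
Hypothesis triB : triangular_basis B.

Let natB : natural_basis mul B. Proof. by case: triB. Qed.
Let basisB : basis_of fullv B. Proof. by case: natB. Qed.

Lemma tail_mul k x y : x \in tail B k -> mul x y \in tail B k.+1.
Proof.
move/(tailP basisB) => x0; rewrite (mul_natural x y natB); apply: memv_suml => i _.
have [/x0-> | le_ki] := ltnP i k; first by rewrite mul0r scale0r mem0v.
by apply/memvZ/(subvP (tail_anti basisB _)); last exact: triB.2.
Qed.

(** The squares e_i^2 with i > k lie in [tail B k.+2], so only the leading term survives modulo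
    it. *)
Lemma tail_mul_mod (k : 'I_n) x y : x \in tail B k ->
  mul x y - (coord B k x * coord B k y) *: mul B`_k B`_k \in tail B k.+2.
Proof.
move/(tailP basisB) => x0; rewrite (mul_natural x y natB) (bigD1 k) //= addrAC subrr add0r.
apply: memv_suml => i i'k; have [le_ik | lt_ki] := leqP i k.
  by rewrite x0 ?mul0r ?scale0r ?mem0v // ltn_neqAle i'k.
by apply/memvZ/(subvP (tail_anti basisB _)); last exact: triB.2.
Qed.

Lemma tail_subalgebra k : subalgebra mul (tail B k).
Proof.
move=> x y xk yk; apply: (subvP (tail_anti basisB (leqnSn k))).
exact: tail_mul.
Qed.

Lemma tail_alg_pow k m : (0 < m)%N -> (2 ^ k < m.*2)%N ->
  (alg_pow mul m <= tail B k)%VS.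
Proof.
apply: alg_pow_filtration (tail0 basisB) _ _ _; last exact: tail_mul.
by move=> x y; rewrite !(mul_natural _ _ natB); apply: eq_bigr => i _; rewrite mulrC.
Qed.

(** The doubled bound means m > 2^(n-1) and also covers n = 0. By [alg_pow_neq0] it is sharp when
    the superdiagonal has no zero. *)
Lemma alg_pow_eq0 m : (0 < m)%N -> (2 ^ n < m.*2)%N -> alg_pow mul m = 0%VS.
Proof. by move=> m0 /(tail_alg_pow m0); rewrite tail_ge // subv0 => /eqP. Qed.

(** * Consequences of a nonzero superdiagonal *)

Section NonzeroSuperdiagonal.

Hypothesis superB : nonzero_superdiagonal B.

(** By [tail_mul_mod] the product is a nonzero multiple of e_k^2 modulo [tail B k.+2]. Serves both
    for squares and for multiplication by a fixed u. *)
Lemma mul_notin_tail (k : 'I_n) x y : (k.+1 < n)%N ->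
  x \in tail B k -> coord B k x != 0 -> coord B k y != 0 ->
  mul x y \notin tail B k.+2.
Proof.
move=> lt_kn xk x0 y0; have := tail_mul_mod y xk.
set c := (_ * _) => xyk; apply: contra (superB lt_kn) => xyk2.
have := memvB xyk2 xyk; rewrite opprB addrC subrK => /(memvZ c^-1).
by rewrite scalerA mulVf ?scale1r // mulf_neq0.
Qed.

Lemma sqr_notin_tail k x : (k.+1 < n)%N ->
  x \in tail B k -> x \notin tail B k.+1 -> mul x x \notin tail B k.+2.
Proof.
move=> lt_kn xk; have lt_k := ltnW lt_kn.
rewrite (memv_tailS basisB (k := Ordinal lt_k)) // => x0.
exact: (mul_notin_tail (k := Ordinal lt_k)).
Qed.

Lemma iter_sqr_tail k : (k < n)%N ->
  exists x, [/\ x \in alg_pow mul (2 ^ k), x \in tail B k & x \notin tail B k.+1].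
Proof.
elim: k => [|k IHk] lt_kn.
  exists (B`_0); rewrite mem_alg_pow1 (tail0 basisB) memvf; split=> //.
  rewrite (memv_tailS basisB (k := Ordinal lt_kn)) ?(tail0 basisB) ?memvf //.
  by rewrite (coord_free (Ordinal lt_kn)) ?(basis_free basisB) // eqxx oner_eq0.
have [x [xE xk x'k]] := IHk (ltnW lt_kn); exists (mul x x); split.
- by rewrite expnS mul2n -addnn mul_alg_pow ?expn_gt0.
- exact: tail_mul.
- exact: sqr_notin_tail.
Qed.

Lemma alg_pow_neq0 m : (0 < m)%N -> (m.*2 <= 2 ^ n)%N -> alg_pow mul m <> 0%VS.
Proof.
move=> m_gt0; have [-> | n_gt0] := posnP n; first by case: m m_gt0.
rewrite -(prednK n_gt0) expnS mul2n leq_double => le_m Em.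
have [|x [xE _ x'n]] := iter_sqr_tail (k := n.-1); first by rewrite prednK.
have /subvP/(_ x xE) := alg_pow_anti mul m_gt0 le_m.
by rewrite Em memv0 => /eqP x0; rewrite x0 mem0v in x'n.
Qed.

Lemma subalgebra_tail (A : {vspace E}) : subalgebra mul A ->
  exists2 k, (k <= n)%N & A = tail B k.
Proof.
move=> subA.
have exk : exists k, (A <= tail B k)%VS && (k <= n)%N.
  by exists 0%N; rewrite tail0 // subvf.
(* Here k is the index of the deepest tail containing A; for A = 0 it is n, and no depth is left to
   fill. *)
have [|k /andP[sAk le_kn] maxk] := @ex_maxnP _ n exk; first by move=> k /andP[].
exists k => //; apply/eqP; rewrite eqEsubv sAk /=.
(* A vector of A outside [tail B k.+1], squared d times, stays in A and has depth k + d. *)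
apply: tail_subv => // j /andP[/subnKC <-]; elim: (j - k)%N => [|d IHd].
  rewrite addn0 => lt_kn; have /subvPn[x xA x'k] : ~~ (A <= tail B k.+1)%VS.
    by apply/negP => sAk1; have := maxk k.+1; rewrite sAk1 lt_kn ltnn => /(_ isT).
  by exists x; split=> //; apply: (subvP sAk).
rewrite addnS => lt_d; have [x [xA xk x'k]] := IHd (ltnW lt_d).
exists (mul x x); split; [exact: subA | exact: tail_mul | exact: sqr_notin_tail].
Qed.

Lemma chain_of_superdiagonal : subalgebra_lattice_chain mul n.
Proof.
(* Reversing the index makes the chain increase: the i-th term has dimension i. *)
exists (fun i => tail B (n - i)%N); split=> [i j lt_ij | A].
  rewrite tail_anti ?leq_sub2l // 1?ltnW //=; apply: contraTneq lt_ij => Dij.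
  have := congr1 (fun U : {vspace E} => \dim U) Dij.
  by rewrite !dim_tail // !subKn -1?ltnS // => ->; rewrite ltnn.
split=> [/subalgebra_tail[k le_kn ->] | [i ->]]; last exact: tail_subalgebra.
have lt_k : (n - k < n.+1)%N by rewrite ltnS leq_subr.
by exists (Ordinal lt_k); rewrite /= subKn.
Qed.

Lemma principal_powers_of_superdiagonal : spanned_by_principal_powers mul.
Proof.
(* As no coordinate of u vanishes, multiplication by u takes depth k to exactly k + 1 while k + 1 <
   n. *)
pose u := \sum_(i < n) B`_i.
have u1 i : coord B i u = 1.
  rewrite linear_sum (bigD1 i) //= coord_free ?(basis_free basisB) // eqxx.
  rewrite big1 ?addr0 // => j /negPf j'i.
  by rewrite coord_free ?(basis_free basisB) // j'i.
have uk k : (k < n)%N -> principal_power mul u k.+1 \in tail B k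
      /\ principal_power mul u k.+1 \notin tail B k.+1.
  elim: k => [|k IHk] lt_kn.
    rewrite tail0 // memvf; split=> //.
    by rewrite (memv_tailS basisB (k := Ordinal lt_kn)) ?tail0 ?memvf // u1 oner_eq0.
  have lt_k := ltnW lt_kn; have [xk x'k] := IHk lt_k; split; first exact: tail_mul.
  apply: (mul_notin_tail (k := Ordinal lt_k)); rewrite ?u1 ?oner_eq0 //.
  by rewrite -memv_tailS.
exists u => x; exists n.
suff /subvP-> :
  (tail B 0 <= <<[seq principal_power mul u k | k <- iota 1 n]>>)%VS => //.
  by rewrite tail0 // memvf.
apply: tail_subv => // j /= lt_jn; have [xj x'j] := uk j lt_jn.
exists (principal_power mul u j.+1); split=> //.
by apply/memv_span/map_f; rewrite mem_iota /= add1n ltnS.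
Qed.

End NonzeroSuperdiagonal.

End Triangular.

End TriangularBases.

(** * Existence of a triangular natural basis *)

Section TriangularExistence.

Variables (K : fieldType) (E : vectType K) (mul : {bilinear E -> E -> E}).

(* With E^N = 0, the height of x is the largest k < N with x^2 in E^k. *)
Definition sqr_height N x :=
  count (fun k => mul x x \in alg_pow mul k.+1) (iota 0 N).

(** Each k counted for x gives k + 1 for y, and k = 0 always counts for y. The last k does not count
    for x because E^N = 0, so the shift stays in range. *)
Lemma sqr_height_lt N x y : (0 < N)%N -> alg_pow mul N = 0%VS -> mul x x != 0 ->
  (forall k, (0 < k)%N -> mul x x \in alg_pow mul k ->
     mul y y \in alg_pow mul k.+1) ->
  (sqr_height N x < sqr_height N y)%N.
Proof.
case: N => // N _ EN x0 xy.
have -> : sqr_height N.+1 x =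
    count (fun k => mul x x \in alg_pow mul k.+1) (iota 0 N).
  rewrite /sqr_height -[X in iota 0 X]addn1 iotaD count_cat add0n /=.
  by rewrite EN memv0 (negPf x0) !addn0.
rewrite /sqr_height /= mem_alg_pow1 add1n ltnS (iotaDl 1 0) count_map.
by apply: sub_count => k; apply: xy.
Qed.

Lemma natural_basis_perm n (B B' : n.-tuple E) :
  perm_eq B' B -> natural_basis mul B -> natural_basis mul B'.
Proof.
move=> eqB [basisB B0].
have basisB' : basis_of fullv B' by rewrite (perm_basis _ eqB).
split=> // i j i'j.
have inB k : exists l, tnth B' k = tnth B l.
  by apply/tnthP; rewrite -(perm_mem eqB) mem_tnth.
have [[i1 Di] [j1 Dj]] := (inB i, inB j); rewrite Di Dj B0 //.
apply: contra_neq i'j => Dij; have := free_uniq (basis_free basisB').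
by move/tuple_uniqP; apply; rewrite Di Dj Dij.
Qed.

(** Sort a natural basis by height. If e_j occurs in e_i^2 with coefficient c, then e_i^2 e_j = c
    e_j^2, so e_j^2 lies one power deeper than e_i^2 and e_j must come after e_i. *)
Lemma triangular_basis_exists : evolution_algebra mul -> nilpotent_algebra mul ->
  exists B : (\dim {:E}).-tuple E, triangular_basis mul B.
Proof.
case=> B natB [N N_gt0 EN]; pose h := sqr_height N.
pose leh := relpre h leq; pose B' := [tuple of sort leh B].
have natB' : natural_basis mul B'.
  by apply: natural_basis_perm natB; rewrite perm_sort.
have [basisB' _] := natB'; exists B'; split=> // i; apply/(tailP basisB') => j le_ji.
apply/eqP; rewrite -[_ == 0]negbK; apply/negP => c0.
have : (h (B'`_j)%R <= h (B'`_i)%R)%N.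
  have leh_tr : transitive leh by move=> x y z; apply: leq_trans.
  have leh_refl : reflexive leh by move=> x; apply: leqnn.
  apply: (sorted_leq_nth leh_tr leh_refl 0); rewrite ?inE ?size_tuple //.
  by apply: sort_sorted => x y; apply: leq_total.
apply/negP; rewrite -ltnNge; apply: sqr_height_lt => //.
  by apply: contraNneq c0 => ->; rewrite linear0.
move=> k k_gt0 ik; have : mul (mul B'`_i B'`_i) B'`_j \in alg_pow mul k.+1.
  by rewrite -addn1 mul_alg_pow ?mem_alg_pow1.
rewrite (mul_natural _ B'`_j natB') (bigD1 j) //= big1 ?addr0 => [|l /negPf l'j].
  rewrite coord_free ?(basis_free basisB') // eqxx mulr1.
  by move/(memvZ (coord B' j (mul B'`_i B'`_i))^-1); rewrite scalerA mulVf // scale1r.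
by rewrite coord_free ?(basis_free basisB') // eq_sym l'j mulr0 scale0r.
Qed.

End TriangularExistence.

(** * A model with nonzero superdiagonal *)

Section ShiftAlgebra.

Variables (K : fieldType) (E : vectType K) (n : nat) (B : n.-tuple E).

(* The evolution algebra with e_i^2 = e_(i+1), where e_n = 0 comes from the
   default value of nth. *)
Definition shift_mul (x y : E) : E :=
  \sum_i (coord B i x * coord B i y) *: B`_i.+1.

Lemma shift_mul_is_bilinear : bilinear_for *:%R *:%R shift_mul.
Proof.
split=> z a x y; rewrite /shift_mul /= scaler_sumr -big_split; apply: eq_bigr => i _ /=.
  by rewrite linearP mulrDl scalerDl scalerA mulrA.
by rewrite linearP mulrDr scalerDl scalerA mulrCA.
Qed.

HB.instance Definition _ :=
  bilinear_isBilinear.Build K E E E *:%R *:%R shift_mul shift_mul_is_bilinear.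

Hypothesis basisB : basis_of fullv B.

Lemma shift_mul_basis (i j : 'I_n) :
  shift_mul B`_i B`_j = if i == j then B`_i.+1 else 0.
Proof.
rewrite /shift_mul (bigD1 i) //= big1 ?addr0 => [|k /negPf k'i].
  rewrite !coord_free ?(basis_free basisB) // eqxx mul1r eq_sym.
  by case: eqP; rewrite ?scale1r ?scale0r.
by rewrite coord_free ?(basis_free basisB) // eq_sym k'i mul0r scale0r.
Qed.

Lemma shift_natural_basis : natural_basis shift_mul B.
Proof.
split=> // i j /negPf i'j; rewrite !(tnth_nth 0) /=.
by have := shift_mul_basis i j; rewrite i'j.
Qed.

Lemma shift_triangular_basis : triangular_basis shift_mul B.
Proof.
split=> [|i]; first exact: shift_natural_basis.
have := shift_mul_basis i i; rewrite eqxx /= => ->.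
have [lt_in | le_ni] := ltnP i.+1 n; last first.
  by rewrite nth_default ?mem0v ?size_tuple.
by apply: memv_span; rewrite -[X in B`_X]addn0 -nth_drop mem_nth //
  size_drop size_tuple subn_gt0.
Qed.

Lemma shift_nonzero_superdiagonal : nonzero_superdiagonal shift_mul B.
Proof.
move=> i lt_in; have := shift_mul_basis i i; rewrite eqxx /= => ->.
apply/negP=> /(tailP basisB)/(_ (Ordinal lt_in) (leqnn _)) /eqP.
by rewrite (coord_free (Ordinal lt_in)) ?(basis_free basisB) // eqxx oner_eq0.
Qed.

End ShiftAlgebra.

(** * A zero on the superdiagonal *)

Section DegenerateSuperdiagonal.

Variables (K : fieldType) (E : vectType K) (mul : {bilinear E -> E -> E}).
Variables (n : nat) (B : n.-tuple E) (i : 'I_n).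
Hypothesis triB : triangular_basis mul B.
Hypothesis lt_in : (i.+1 < n)%N.
Hypothesis sqri : mul B`_i B`_i \in tail B i.+2.

Let natB : natural_basis mul B. Proof. by case: triB. Qed.
Let basisB : basis_of fullv B. Proof. by case: natB. Qed.

(* Multiplication maps both tail i and tail i.+1 into tail i.+2, so tail i.+1
   can be skipped, which halves the bound of alg_pow_eq0. *)
Lemma degenerate_alg_pow_eq0 m : (0 < m)%N -> (2 ^ n.-1 < m.*2)%N ->
  alg_pow mul m = 0%VS.
Proof.
pose V k := tail B (if (k <= i)%N then k else k.+1).
move=> m_gt0 lt_nm; apply/eqP; rewrite -subv0 -(tail_ge B (leqnn n)).
have -> : tail B n = V n.-1.
  have n_gt0 : (0 < n)%N by apply: leq_trans lt_in.
  by rewrite /V leqNgt -ltnS prednK // lt_in.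
apply: alg_pow_filtration lt_nm => //; last move=> k x y.
- by apply: evolution_mulC; rewrite /evolution_algebra (size_basis basisB); exists B.
- exact: tail0.
rewrite /V; case: (ltngtP k i) => [lt_ki | lt_ik | ->]; try exact: tail_mul.
move=> xi; have := tail_mul_mod triB y xi; set c := (_ * _) => xyi.
by rewrite -(subrK (c *: mul B`_i B`_i) (mul x y)) memvD // memvZ.
Qed.

Lemma degenerate_square : exists2 S : {vspace E},
  (\dim S + 2 <= n)%N & forall x y, mul x y \in S.
Proof.
pose s := [seq mul b b | b <- take i B].
(* The first i squares contribute dimension at most i and the tail n - i - 2; all later squares, and
   e_i^2 by hypothesis, lie in the tail. *)
exists (<<s>> + tail B i.+2)%VS => [|x y].
  have dim_s : (\dim <<s>> <= i)%N.
    by apply: leq_trans (dim_span s) _; rewrite size_map size_take geq_minl.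
  have := leq_trans (dimv_add_leqif <<s>> (tail B i.+2)).1 (leq_add dim_s (leqnn _)).
  rewrite dim_tail // -(leq_add2r 2) => /leq_trans; apply.
  by rewrite addnAC addn2 subnKC.
rewrite (mul_natural x y natB); apply: memv_suml => j _; apply: memvZ.
have [lt_ji | lt_ij | /val_inj->] := ltngtP j i; last first.
- exact: subvP (addvSr _ _) _ sqri.
- by apply: (subvP (addvSr _ _)); apply: subvP (triB.2 j); apply: tail_anti.
apply/(subvP (addvSl _ _))/memv_span/mapP; exists B`_j => //.
by rewrite -(nth_take 0 lt_ji) mem_nth // size_takel ?size_tuple // ltnW // ltn_ord.
Qed.

End DegenerateSuperdiagonal.

Lemma superdiagonalP (K : fieldType) (E : vectType K)
    (mul : {bilinear E -> E -> E}) n (B : n.-tuple E) :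
  nonzero_superdiagonal mul B \/
  exists2 i : 'I_n, (i.+1 < n)%N & mul B`_i B`_i \in tail B i.+2.
Proof.
have [/existsP[i /andP[]] | /existsPn noi] :=
  boolP [exists i : 'I_n, (i.+1 < n)%N && (mul B`_i B`_i \in tail B i.+2)].
  by right; exists i.
by left=> i lt_in; have := noi i; rewrite lt_in.
Qed.

(** * Chains, distributivity and the codimension of the square *)

Section SubalgebraLattice.

Variables (K : fieldType) (E : vectType K) (mul : {bilinear E -> E -> E}).

(** In a chain the intersection of V and W is the smaller of the two, so the law reduces to
    monotonicity of generation. *)
Lemma distributive_of_chain n :
  subalgebra_lattice_chain mul n -> distributive_algebra mul.
Proof.
case=> T [leT subT] U V W _ subV subW x.
wlog sVW : V W subV subW / (V <= W)%VS => [IH|].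
  have [[i DV] [j DW]] := (iffLR (subT V) subV, iffLR (subT W) subW).
  have [le_ij | lt_ji] := leqP i j.
    apply: IH => //; rewrite DV DW; move: le_ij.
    by rewrite leq_eqVlt => /predU1P[/val_inj-> // | /leT/andP[]].
  have sWV : (W <= V)%VS by rewrite DV DW; have /andP[] := leT _ _ lt_ji.
  rewrite capvC; case: (IH W V subW subV sWV) => h1 h2.
  by split=> [/h1[] | []] // *; apply: h2.
rewrite (capv_idPl sVW); split=> [xV | [] //]; split=> // A subA sA.
apply: xV => // y; rewrite !inE => /orP[yU | yV]; apply: sA; rewrite !inE ?yU //.
by rewrite (subvP sVW) ?orbT.
Qed.

(* Any subspace between S and E is a subalgebra, and the three lines S + a,
   S + b and S + (a + b) of a plane modulo S violate distributivity. *)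
Lemma distributive_square (S : {vspace E}) : distributive_algebra mul ->
  (forall x y, mul x y \in S) -> (\dim {:E} <= (\dim S).+1)%N.
Proof.
move=> distE mulS; rewrite leqNgt; apply/negP => lt_S.
have subalgS (T : {vspace E}) : (S <= T)%VS -> subalgebra mul T.
  by move=> sST x y _ _; apply: (subvP sST).
have exN (T : {vspace E}) : (\dim T < \dim {:E})%N -> exists a, a \notin T.
  move=> lt_T; have /subvPn[a _] : ~~ (fullv <= T)%VS.
    by apply: contraL lt_T => /dimvS; rewrite -leqNgt.
  by exists a.
have [a aS] := exN S (ltnW lt_S).
have [|b bSa] := exN (S + <[a]>)%VS.
  apply: leq_ltn_trans (dimv_add_leqif _ _).1 (leq_ltn_trans _ lt_S).
  by rewrite dim_vline -addn1 leq_add2l leq_b1.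
pose U := (S + <[a + b]>)%VS; pose V := (S + <[a]>)%VS; pose W := (S + <[b]>)%VS.
have [aV bW] : a \in V /\ b \in W.
  by split; apply: (subvP (addvSr _ _)); apply: memv_line.
have abU : a + b \in U by apply: (subvP (addvSr _ _)); apply: memv_line.
have [_ dUVW] := distE U V W (subalgS _ (addvSl _ _)) (subalgS _ (addvSl _ _))
  (subalgS _ (addvSl _ _)) a.
(* Since a = (a + b) - b, it lies in both generated subalgebras on the right; distributivity then
   leaves only U, as V and W meet inside U. *)
have : a \in U.
  apply: dUVW => [|//|x].
  - split=> A subA sA; first by apply: sA; rewrite !inE aV orbT.
    by rewrite -[a](addrK b) memvB // sA // !inE ?abU ?bW ?orbT.
  - exact: subalgS (addvSl _ _).
  rewrite !inE => /orP[// |]; rewrite memv_cap => /andP[].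
  move=> /memv_addP[s sS [_ /vlineP[c ->] ->]] /memv_addP[t tS [_ /vlineP[d ->] Dx]].
  (* A nonzero coefficient of b would put b in S + <a>. *)
  have [d0 | d0] := eqVneq d 0.
    by rewrite Dx d0 scale0r addr0; apply: (subvP (addvSl _ _)).
  case/negP: bSa; rewrite -(scalerK d0 b); apply: memvZ.
  rewrite -[d *: b](addKr t) -Dx addrA; apply: memv_add; last exact/memvZ/memv_line.
  by rewrite memvD ?memvN.
case/memv_addP=> s sS [_ /vlineP[c ->] Da].
(* Either a lies in S, or dividing by c puts b in S + <a>; both are excluded. *)
have [c0 | c0] := eqVneq c 0.
  by case/negP: aS; rewrite Da c0 scale0r addr0.
case/negP: bSa; rewrite -(scalerK c0 b); apply: memvZ.
have -> : c *: b = - s + (1 - c) *: a.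
  by rewrite scalerBl scale1r {1}Da scalerDr addrA addKr [c *: a + _]addrC addrK.
by apply: memv_add; rewrite ?memvN // memvZ ?memv_line.
Qed.

(** All principal powers except u itself are products, so they span a subspace of S + <u>. *)
Lemma principal_powers_square (S : {vspace E}) :
  spanned_by_principal_powers mul ->
  (forall x y, mul x y \in S) -> (\dim {:E} <= (\dim S).+1)%N.
Proof.
case=> u spanu mulS.
have sE : (fullv <= S + <[u]>)%VS.
  apply/subvP=> x _; have [m xm] := spanu x; apply: subvP xm.
  apply/span_subvP => _ /mapP[k _ ->].
  case: k => [|[|k]]; last by apply: (subvP (addvSl _ _)); apply: mulS.
    by apply: (subvP (addvSr _ _)); apply: memv_line.
  by apply: (subvP (addvSr _ _)); apply: memv_line.
apply: leq_trans (dimvS sE) (leq_trans (dimv_add_leqif _ _).1 _).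
by rewrite dim_vline -addn1 leq_add2l leq_b1.
Qed.

End SubalgebraLattice.

(** * Comparison of nilpotency indices *)

Section MaximalIndex.

Variables (K : fieldType) (E : vectType K) (mul : {bilinear E -> E -> E}).
Variable B : (\dim {:E}).-tuple E.
Hypothesis triB : triangular_basis mul B.

(** E^k = 0 forces 2k > 2^n, and this bound kills the k-th power of every competitor of the same
    dimension. *)
Lemma max_index_of_superdiagonal : nilpotent_algebra mul ->
  nonzero_superdiagonal mul B -> max_nilpotency_index mul.
Proof.
case/nilpotency_indexP => k Ek superB; exists k => //.
move=> F mulF l dimF evolF nilF [l_gt0 Fl minl].
case: Ek => k_gt0 Ek _; have [C triC] := triangular_basis_exists evolF nilF.
apply: minl => //; apply: (alg_pow_eq0 triC) => //; rewrite dimF ltnNge.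
by apply/negP => /(alg_pow_neq0 triB superB k_gt0).
Qed.

(** With a zero on the superdiagonal the index is at most 2^(n-1), which [shift_mul B], a competitor
    on the same space, exceeds. *)
Lemma superdiagonal_of_max_index :
  max_nilpotency_index mul -> nonzero_superdiagonal mul B.
Proof.
case=> k [k_gt0 Ek mink] maxk; have [// | [i lt_in sqri]] := superdiagonalP mul B.
have basisB : basis_of fullv B by case: triB => -[].
have n_gt0 : (0 < \dim {:E})%N by apply: leq_trans lt_in.
have D2n : (2 ^ \dim {:E} = (2 ^ (\dim {:E}).-1).*2)%N.
  by rewrite -[in LHS](prednK n_gt0) expnS mul2n.
have le_k : (k <= 2 ^ (\dim {:E}).-1)%N.
  apply: mink; first by rewrite expn_gt0.
  apply: (degenerate_alg_pow_eq0 triB lt_in sqri); first by rewrite expn_gt0.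
  by rewrite -addnn -[X in (X < _)%N]addn0 ltn_add2l expn_gt0.
have triS := shift_triangular_basis basisB.
have nilS : nilpotent_algebra (shift_mul B).
  exists (2 ^ \dim {:E})%N; first by rewrite expn_gt0.
  apply: (alg_pow_eq0 triS); first by rewrite expn_gt0.
  by rewrite -addnn -[X in (X < _)%N]addn0 ltn_add2l expn_gt0.
have [l Sl] := nilpotency_indexP nilS; have [l_gt0 Sl0 _] := Sl.
case: (alg_pow_neq0 triS (shift_nonzero_superdiagonal basisB) l_gt0 _ Sl0).
rewrite D2n leq_double; apply: leq_trans le_k.
apply: (maxk E (shift_mul B)) => //.
by exists B; apply: shift_natural_basis.
Qed.

End MaximalIndex.

Theorem theorem5p1 (K : fieldType) (n : nat) (E : vectType K)
    (mul : {bilinear E -> E -> E})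
    (dimE : \dim {:E} = n)
    (evolE : evolution_algebra mul)
    (nilE : nilpotent_algebra mul) :
  [<-> max_nilpotency_index mul;
       subalgebra_lattice_chain mul n;
       distributive_algebra mul;
       spanned_by_principal_powers mul].
Proof.
rewrite -{n}dimE; have [B triB] := triangular_basis_exists evolE nilE.
(* Shared by distributivity and spanning: each bounds the codimension of any S containing all
   products by 1, against [degenerate_square]. *)
have superB (P : Prop) : P ->
    (P -> forall S : {vspace E}, (forall x y, mul x y \in S) ->
       (\dim {:E} <= (\dim S).+1)%N) ->
    nonzero_superdiagonal mul B.
  move=> hP dimS; have [// | [i lt_in sqri]] := superdiagonalP mul B.
  have [S leS mulS] := degenerate_square triB lt_in sqri.
  by have := leq_trans leS (dimS hP S mulS); rewrite addn2 ltnn.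
tfae.
- move=> maxE; apply: (chain_of_superdiagonal triB).
  exact: superdiagonal_of_max_index triB maxE.
- exact: distributive_of_chain.
- move=> distE; apply: (principal_powers_of_superdiagonal triB (superB _ distE _)).
  by move=> dE S; apply: distributive_square.
- move=> spanE; apply: (max_index_of_superdiagonal triB nilE (superB _ spanE _)).
  by move=> sE S; apply: principal_powers_square.
Qed.
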